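(* Let $\mathbb{F}$ be a field, and let $\omega_0$ and $f:\mathbb{N}\to(0,1)$ with $f(N)=1/\Theta(\sqrt{\log N})$ be as in the known result described in the context. Then for all positive integers $N$ there exist integers $m,H,C$ with $m,H=2^{\Theta(N)}$ and $C\le 2^{O(N/\log N)}$ such that, for all sufficiently large positive integers $k$, \[ T(m^k,m^k,m^k)\le H^{1/\Theta(\sqrt{\log N})}\cdot m^{(\omega_0+f(N))k}+O\big(m^{\omega_0+f(\sqrt N)}\cdot N\big)\cdot m^{2k}\le 2^{O(N/\sqrt{\log N})}\cdot m^{(\omega_0+f(N))k}+2^{O(N\log N)}\cdot m^{2k}. \]
   Context: $T(n,m,d)$ denotes the minimum number of field operations ($+,-,\times,\div$) of an arithmetic circuit over $\mathbb{F}$ computing the product of an $n\times m$ matrix and an $m\times d$ matrix. Tensors are trilinear forms $\sum\mathcal{T}[i,j,k]x_iy_jz_k$ over $\mathbb{F}$; rank $R(\cdot)$ is the minimum number of rank-1 tensors (products of three linear forms) summing to the tensor. $\langle n,m,d\rangle=\sum_{i\in[n],j\in[m],k\in[d]}a_{ij}b_{jk}c_{ki}$. For a tensor $\mathcal{T}$ and positive integer $H$, $H\odot\mathcal{T}$ is the direct sum of $H$ copies of $\mathcal{T}$ on disjoint variable sets; $\mathcal{T}^{\otimes N}$ is the $N$-th Kronecker power. $\mathcal{T}'\le\mathcal{T}$ (''zeroing out'') means $\mathcal{T}'$ is obtained (up to renaming variables) from $\mathcal{T}$ by setting some variables to $0$. The Coppersmith–Winograd tensor is $\mathrm{CW}_q=\sum_{i=1}^q(x_0y_iz_i+x_iy_0z_i+x_iy_iz_0)+x_0y_0z_{q+1}+x_0y_{q+1}z_0+x_{q+1}y_0z_0$.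 Known result (prior work of Duan–Wu–Zhou, Vassilevska Williams–Xu–Xu–Zhou, Alman et al.): $\omega_0<2.372$ denotes the current best upper bound on the matrix multiplication exponent, and there is $f:\mathbb{N}\to(0,1)$ with $f(N)=1/\Theta(\sqrt{\log N})$ such that for all positive integers $N$ there exist integers $m,H,C$ with $m,H=2^{\Theta(N)}$, $C\le 2^{O(N/\log N)}$, $H\odot\langle m,m,m\rangle\le C\odot\mathrm{CW}_5^{\otimes N}$ and $C\cdot R(\mathrm{CW}_5^{\otimes N})/H\le m^{\omega_0+f(N)}$. *)

(* Defs.v *)
From HB Require Import structures.
From mathcomp Require Import all_boot all_order all_algebra.
From mathcomp Require Import all_classical all_reals all_analysis.
From mathcomp Require mpoly.
Import (canonicals) mpoly.

Set Implicit Arguments.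
Unset Strict Implicit.
Unset Printing Implicit Defensive.

Import Order.TTheory GRing.Theory Num.Theory.
Import numFieldNormedType.Exports.

Local Open Scope classical_set_scope.
Local Open Scope ring_scope.

(* The default 0 is used only when no natural number satisfies P. *)
Definition least (P : nat -> Prop) : nat :=
  if pselect (exists n, `[< P n >]) is left exP then ex_minn exP else 0%N.

(* Arithmetic circuits, as straight-line programs: the size of a circuit is
   the number of its operations, inputs and constants being free. *)

Variant arith_op := Add | Sub | Mul | Div.

Variant operand (F I : Type) :=
  | Input of I
  | Const of F
  | Wire of nat. (* the result of the gate of this rank; 0 if there is none *)

Record gate (F I : Type) := Gate {
  gate_op : arith_op;
  gate_lhs : operand F I;
  gate_rhs : operand F I
}.

Definition circuit (F I : Type) := seq (gate F I).

(* Evaluation in a field K, given the values of constants and of inputs;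
   [vals] lists the results of the gates evaluated so far. *)
Section Evaluation.
Variables (F I : Type) (K : fieldType) (iota : F -> K) (x : I -> K).

Definition operand_val (vals : seq K) (o : operand F I) : K :=
  match o with
  | Input i => x i
  | Const c => iota c
  | Wire l => vals`_l
  end.

Definition gate_val (vals : seq K) (g : gate F I) : option K :=
  let a := operand_val vals (gate_lhs g) in
  let b := operand_val vals (gate_rhs g) in
  match gate_op g with
  | Add => Some (a + b)
  | Sub => Some (a - b)
  | Mul => Some (a * b)
  | Div => if b == 0 then None else Some (a / b)
  end.

(* [None] as soon as some gate divides by zero. *)
Fixpoint run (vals : seq K) (c : circuit F I) : option (seq K) :=
  match c with
  | [::] => Some vals
  | g :: c' => if gate_val vals g is Some v then run (rcons vals v) c' else None
  end.

Definition computes (J : Type) (c : circuit F I) (y : J -> K) : Prop :=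
  exists2 vals, run [::] c = Some vals &
    forall j, exists o, operand_val vals o = y j.

End Evaluation.

(* The entries of the two input matrices are the indeterminates of a field of
   rational functions, in which the circuit is evaluated; in particular, over a
   finite field, equality of functions on F is not enough. *)
Section MatrixMultiplication.
Variables (F : fieldType) (n m d : nat).

Definition ratfun : fieldType := {fraction (mpoly.mpoly (n * m + m * d) F)}.

Definition ratfun_const (c : F) : ratfun :=
  tofrac (mpoly.mpolyC (n * m + m * d) c).

Definition ratfun_var (v : 'I_(n * m + m * d)) : ratfun :=
  tofrac (mpoly.mpolyX F (mpoly.mnm1 v)).

Definition left_mx : 'M[ratfun]_(n, m) :=
  \matrix_(i, j) ratfun_var (lshift (m * d) (mxvec_index i j)).

Definition right_mx : 'M[ratfun]_(m, d) :=
  \matrix_(j, k) ratfun_var (rshift (n * m) (mxvec_index j k)).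

Definition computes_mulmx (c : circuit F 'I_(n * m + m * d)) : Prop :=
  computes ratfun_const ratfun_var c
    (fun ik : 'I_n * 'I_d => (left_mx *m right_mx) ik.1 ik.2).

Definition mulmx_cost : nat :=
  least (fun s => exists2 c, computes_mulmx c & size c = s).

End MatrixMultiplication.

(* A tensor is given by its coefficients: t i j k is that of x_i y_j z_k, where
   X, Y and Z index the three sets of variables. *)
Section Tensors.
Variable F : fieldType.

Definition tensor (X Y Z : finType) := X -> Y -> Z -> F.

Definition rank_one (X Y Z : finType) (t : tensor X Y Z) : Prop :=
  exists (a : X -> F) (b : Y -> F) (c : Z -> F),
    forall i j k, t i j k = a i * b j * c k.

Definition tensor_rank (X Y Z : finType) (t : tensor X Y Z) : nat :=
  least (fun r => exists2 u : 'I_r -> tensor X Y Z,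
    (forall l, rank_one (u l)) & (forall i j k, t i j k = \sum_(l < r) u l i j k)).

Definition matmul_tensor (n m d : nat) :
    tensor ('I_n * 'I_m)%type ('I_m * 'I_d)%type ('I_d * 'I_n)%type :=
  fun a b c => ((a.2 == b.1) && (b.2 == c.1) && (c.2 == a.1))%:R.

Definition copies (H : nat) (X Y Z : finType) (t : tensor X Y Z) :
    tensor ('I_H * X)%type ('I_H * Y)%type ('I_H * Z)%type :=
  fun i j k => if (i.1 == j.1) && (j.1 == k.1) then t i.2 j.2 k.2 else 0.

Definition kronecker_pow (N : nat) (X Y Z : finType) (t : tensor X Y Z) :
    tensor {ffun 'I_N -> X} {ffun 'I_N -> Y} {ffun 'I_N -> Z} :=
  fun i j k => \prod_(l < N) t (i l) (j l) (k l).

(* The variables of t outside the images of the three injections are set to 0,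
   and the remaining ones are renamed along the injections. *)
Definition zeroing_out (X' Y' Z' X Y Z : finType)
    (t' : tensor X' Y' Z') (t : tensor X Y Z) : Prop :=
  exists (p : X' -> X) (q : Y' -> Y) (r : Z' -> Z),
    [/\ injective p, injective q, injective r &
        forall i j k, t' i j k = t (p i) (q j) (r k)].

Definition monomial (n : nat) (a b c : nat) : tensor 'I_n 'I_n 'I_n :=
  fun i j k => ((i == a :> nat) && (j == b :> nat) && (k == c :> nat))%:R.

Definition CW (q : nat) : tensor 'I_q.+2 'I_q.+2 'I_q.+2 :=
  fun i j k =>
    \sum_(1 <= l < q.+1) (monomial 0 l l i j k + monomial l 0 l i j k
                          + monomial l l 0 i j k)
    + monomial 0 0 q.+1 i j k + monomial 0 q.+1 0 i j k
    + monomial q.+1 0 0 i j k.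

End Tensors.

Arguments copies {F} H {X Y Z} t.
Arguments kronecker_pow {F} N {X Y Z} t.
Arguments matmul_tensor F n m d : clear implicits.
Arguments CW F q : clear implicits.

Section Asymptotics.
Variable R : realType.

(* Landau relations as the argument tends to infinity *)
Definition is_Theta (u v : nat -> R) : Prop :=
  (u : nat -> R^o) =Theta_\oo (v : nat -> R^o).

Definition is_O (u v : nat -> R) : Prop :=
  (u : nat -> R^o) =O_\oo (v : nat -> R^o).

(* nat-valued u with u = 2^{Theta(g)}, resp. u <= 2^{O(g)}, on positive
   integers *)
Definition exp2_Theta (u : nat -> nat) (g : nat -> R) : Prop :=
  exists2 e : nat -> R, is_Theta e g &
    forall N, (0 < N)%N -> (u N)%:R = 2 `^ e N :> R.

Definition le_exp2_O (u : nat -> nat) (g : nat -> R) : Prop :=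
  exists2 e : nat -> R, is_O e g &
    forall N, (0 < N)%N -> (u N)%:R <= 2 `^ e N :> R.

Definition log (N : nat) : R := ln N%:R.
Definition sqrt_log (N : nat) : R := Num.sqrt (log N).

Definition floor_sqrt (N : nat) : nat := Num.truncn (Num.sqrt (N%:R : R)).

(* The known family of algorithms. It is required for large N only: for N = 1
   no m, H, C satisfy the last two conditions. *)
Definition CW_family (F : fieldType) (omega0 : R) (f : nat -> R) : Prop :=
  exists m H C : nat -> nat,
    [/\ forall N, (0 < N)%N -> [/\ 0 < m N, 0 < H N & 0 < C N]%N,
        exp2_Theta m (fun N => N%:R),
        exp2_Theta H (fun N => N%:R),
        le_exp2_O C (fun N => N%:R / log N) &
        \forall N \near \oo,
          zeroing_out (copies (H N) (matmul_tensor F (m N) (m N) (m N)))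
                      (copies (C N) (kronecker_pow N (CW F 5))) /\
          (C N)%:R * (tensor_rank (kronecker_pow N (CW F 5)))%:R / (H N)%:R
            <= (m N)%:R `^ (omega0 + f N)].

End Asymptotics.

(* Main.v *)
(* Fix N' and m, H given by the family at N'. A decomposition of
   H copies of <m,m,m> into r rank-one terms reduces H products of mn x mn
   matrices to r products of n x n matrices, that is, to at most r/H + 1 batches of H
   products, with O(n^2) additional operations. As r >= H m^2, iterating gives
   T(m^t) = O((r/H + 2)^t), and r/H + 2 <= 3 m^(omega0 + f(N')). Since m tends
   to infinity and f to 0, the factor 3 and f(N') only cost an arbitrarily small
   amount in the exponent: T(n) = O(n^e) for every e > omega0. As f(N) > 0, this
   applies to e = omega0 + f(N)/2, and for k large the remaining factor
   m^(k f(N)/2) absorbs the constant, so that the term in m^(2k) is not needed. *)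
Require Import Defs.
From mathcomp Require Import all_boot all_order all_algebra.
From mathcomp Require Import all_classical all_reals all_analysis.
From mathcomp Require Import zify ring lra.
From mathcomp Require mpoly.
Import (canonicals) mpoly.
Import Order.TTheory GRing.Theory Num.Theory.
Import numFieldNormedType.Exports.
Local Open Scope classical_set_scope.
Local Open Scope ring_scope.
Set Implicit Arguments.
Unset Strict Implicit.
Unset Printing Implicit Defensive.

(** * Least natural numbers with a property *)

Lemma leastP (P : nat -> Prop) : (exists n, P n) -> P (least P).
Proof.
case=> n Pn; rewrite /least; case: pselect => [exP|[]].
  by case: ex_minnP => k /asboolP.
by exists n; apply/asboolP.
Qed.

Lemma least_le (P : nat -> Prop) n : P n -> (least P <= n)%N.
Proof.
move=> Pn; rewrite /least; case: pselect => // exP.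
by case: ex_minnP => k _; apply; apply/asboolP.
Qed.

(** * Sets of values reachable with a bounded number of operations *)

Section StraightLinePrograms.
Variables (F : fieldType) (K : fieldType).

(* [slp A n B]: the values of [B] are obtained from those of [A] by at most [n]
   operations; division is never needed. *)
Inductive slp (A : set K) : nat -> set K -> Prop :=
| slp_id : slp A 0 A
| slp_op n B a b v : slp A n B -> B a -> B b ->
    [\/ v = a + b, v = a - b | v = a * b] -> slp A n.+1 (v |` B)
| slp_weaken n n' B B' :
    slp A n B -> (n <= n')%N -> B' `<=` B -> slp A n' B'.

Lemma slp_trans A B C n n' : slp A n B -> slp B n' C -> slp A (n + n') C.
Proof.
move=> AB; elim=> {n' C} [|n' C a b v _ IH Ca Cb vE|n1 n2 C C' _ IH le12 sub].
- by rewrite addn0.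
- by rewrite addnS; apply: slp_op vE.
- by apply: slp_weaken IH _ sub; rewrite leq_add2l.
Qed.

Lemma slp_frame A B D n : slp A n B -> slp (A `|` D) n (B `|` D).
Proof.
elim=> {n B} [|n B a b v _ IH Ba Bb vE|n1 n2 B B' _ IH le12 sub].
- exact: slp_id.
- by rewrite -setUA; apply: slp_op IH _ _ vE; left.
- by apply: slp_weaken IH le12 _; apply: setSU.
Qed.

Lemma slp_keep A B n : slp A n B -> slp A n (A `|` B).
Proof. by move=> /(@slp_frame _ _ A); rewrite setUid setUC. Qed.

(** The programs run one after another, each keeping the results of the earlier ones. *)
Lemma slp_bigcup A (I : finType) (B : I -> set K) n :
  (forall i, slp A n (B i)) ->
  slp A (#|I| * n) (A `|` \bigcup_(i in [set: I]) B i).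
Proof.
move=> AB.
suff H (s : seq I) : slp A (size s * n) (A `|` \bigcup_(i in [set` s]) B i).
  rewrite cardE; apply: slp_weaken (H (enum I)) (leqnn _) _ => v [Av|[i _ Bv]].
    by left.
  by right; exists i => //=; rewrite mem_enum.
elim: s => [|i s IH].
  by apply: slp_weaken (slp_id A) _ _ => // v [//|[i]].
rewrite /= mulSn addnC; apply: slp_weaken (slp_trans IH _) (leqnn _) _.
  exact: slp_frame (slp_keep (AB i)).
move=> v [Av|[j /=]]; first by left; left.
rewrite inE => /orP[/eqP-> Bv|js Bv]; first by left; right.
by right; exists j.
Qed.

Variable iota : {rmorphism F -> K}.

Lemma slp_lincomb A (I : Type) (s : seq I) (c : I -> F) (y : I -> K) :
  range iota `<=` A -> (forall i, A (y i)) ->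
  slp A (2 * size s) ((\sum_(i <- s) iota (c i) * y i) |` A).
Proof.
move=> iA yA; elim: s => [|i s IH].
  rewrite big_nil; apply: slp_weaken (slp_id A) _ _ => // v [->|//].
  by apply: iA; exists 0 => //; rewrite rmorph0.
rewrite big_cons /= mulnS addnC addn2.
apply: slp_weaken (slp_op (slp_op IH _ _ (Or33 _ _ erefl)) _ _ (Or31 _ _ erefl))
  (leqnn _) _.
- by right; apply: iA; exists (c i).
- by right; apply: yA i.
- by left.
- by right; left.
- by move=> v [->|Av]; [left|right; right; right].
Qed.

Lemma slp_lincombs A (J I : finType) (c : J -> I -> F) (y : J -> I -> K) :
  range iota `<=` A -> (forall j i, A (y j i)) ->
  slp A (#|J| * (2 * #|I|))
      (A `|` range (fun j => \sum_i iota (c j i) * y j i)).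
Proof.
move=> iA yA; pose v j := \sum_i iota (c j i) * y j i.
have Av j : slp A (2 * #|I|) (v j |` A).
  have := slp_lincomb (enum I) (c j) iA (yA j).
  by rewrite -cardE big_enum.
apply: slp_weaken (slp_bigcup Av) (leqnn _) _ => w [Aw|[j _ <-]]; first by left.
by right; exists j => //; left.
Qed.

(** * From reachable values to circuits *)

Section Circuit.
Variables (I : Type) (x : I -> K).

Lemma run_rcons vals (c : circuit F I) g :
  run iota x vals (rcons c g) =
  obind (fun vals' => omap (rcons vals') (gate_val iota x vals' g))
    (run iota x vals c).
Proof.
elim: c vals => [|h c IH] vals /=; first by case: gate_val.
by case: gate_val.
Qed.

(* Values are required to persist when the list of gates is extended, which an
   out-of-range wire, reading the junk value 0, would not do. *)
Lemma slp_circuit A n B :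
  slp A n B -> A `<=` range x `|` range iota ->
  exists (c : circuit F I) (vals : seq K),
    [/\ (size c <= n)%N, run iota x [::] c = Some vals &
        forall b, B b -> exists o, forall w,
          operand_val iota x (vals ++ w) o = b].
Proof.
move=> AB sA; elim: AB => {n B} [|n B a b v _ [c [vals [cn rc oB]]] Ba Bb vE
  |n1 n2 B B' _ [c [vals [cn rc oB]]] le12 sub].
- exists [::], [::]; split=> // b /sA [[i _ <-]|[a _ <-]].
    by exists (Input _ i).
  by exists (Const _ a).
- have [oa oaE] := oB _ Ba; have [ob obE] := oB _ Bb.
  have [op opE] : exists op, gate_val iota x vals (Gate op oa ob) = Some v.
    rewrite /gate_val /= -[vals]cats0 oaE obE.
    by case: vE => ->; [exists Defs.Add|exists Defs.Sub|exists Defs.Mul].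
  exists (rcons c (Gate op oa ob)), (rcons vals v); split.
  + by rewrite size_rcons.
  + by rewrite run_rcons rc /= opE.
  + move=> w [-> | /oB [ow oE]].
      exists (Wire _ _ (size vals)) => w'.
      by rewrite /= cat_rcons nth_cat ltnn subnn.
    by exists ow => w'; rewrite cat_rcons.
- exists c, vals; split=> //; first exact: leq_trans cn le12.
  by move=> b /sub; apply: oB.
Qed.

End Circuit.

(** * Cost of simultaneous matrix products *)

(** The products are independent, one for each element of [L]. The set [A] is arbitrary, so that the
    recursion can multiply matrices of intermediate results; finite types as indices let block
    matrices be indexed by product types. *)
Definition mulcost (L I : finType) (c : nat) : Prop :=
  forall (A : set K) (X Y : L -> I -> I -> K),
    range iota `<=` A ->
    (forall l i j, A (X l i j)) -> (forall l i j, A (Y l i j)) ->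
    slp A c (range (fun p : L * (I * I) =>
      \sum_j X p.1 p.2.1 j * Y p.1 j p.2.2)).

Lemma mulcost_weaken L I c c' :
  mulcost L I c -> (c <= c')%N -> mulcost L I c'.
Proof.
by move=> Hc le A X Y iA XA YA; apply: slp_weaken (Hc A X Y iA XA YA) le _.
Qed.

Definition preimage_of (I J : finType) (g : I -> J) (j : J) : option I :=
  [pick i | g i == j].

Lemma preimage_of_inj (I J : finType) (g : I -> J) i :
  injective g -> preimage_of g (g i) = Some i.
Proof.
move=> gI; rewrite /preimage_of; case: pickP => [i' /eqP/gI-> //|/(_ i)].
by rewrite eqxx.
Qed.

Lemma sum_preimage_of (I J : finType) (g : I -> J) (G : option I -> K) :
  injective g -> G None = 0 ->
  \sum_j G (preimage_of g j) = \sum_i G (Some i).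
Proof.
move=> gI G0; rewrite (partition_big g predT) //=; apply: eq_bigr => j _.
rewrite /preimage_of; case: pickP => [i /eqP <-|noi].
  by rewrite (big_pred1 i) // => i'; rewrite /= (inj_eq gI).
by rewrite big_pred0.
Qed.

(* The products indexed by [L'] and [I'] are padded with zeros. *)
Lemma mulcost_inj (L L' I I' : finType) (f : L' -> L) (g : I' -> I) c :
  injective f -> injective g -> mulcost L I c -> mulcost L' I' c.
Proof.
move=> fI gI Hc A X Y iA XA YA.
pose pad (Z : L' -> I' -> I' -> K) (l : option L') (i j : option I') : K :=
  if (l, i, j) is (Some l, Some i, Some j) then Z l i j else 0.
have padA Z : (forall l i j, A (Z l i j)) -> forall l i j, A (pad Z l i j).
  move=> ZA [l|] [i|] [j|] //=; try exact: ZA;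
  by apply: iA; exists 0 => //; rewrite rmorph0.
pose padded Z l i j := pad Z (preimage_of f l) (preimage_of g i)
                             (preimage_of g j).
apply: slp_weaken (Hc A (padded X) (padded Y) iA _ _) (leqnn _) _.
- by move=> l i j; apply: padA.
- by move=> l i j; apply: padA.
move=> _ [[l [i k]] _ <-]; exists (f l, (g i, g k)) => //=.
rewrite /padded !preimage_of_inj //.
pose G oj := pad X (Some l) (Some i) oj * pad Y (Some l) oj (Some k).
by rewrite (sum_preimage_of (G := G) gI) //= /G mul0r.
Qed.

Lemma mulcost_card (L L' I I' : finType) c :
  (#|L'| <= #|L|)%N -> (#|I'| <= #|I|)%N -> mulcost L I c -> mulcost L' I' c.
Proof.
have card_inj (S T : finType) :
    (#|S| <= #|T|)%N -> exists f : S -> T, injective f.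
  move=> le; exists (fun x => enum_val (widen_ord le (enum_rank x))).
  by move=> x y /enum_val_inj /(congr1 val) /= /val_inj /enum_rank_inj.
by move=> /card_inj[f fI] /card_inj[g gI]; apply: mulcost_inj fI gI.
Qed.

Lemma mulcost_mul (P L I : finType) c :
  mulcost L I c -> mulcost (P * L)%type I (#|P| * c).
Proof.
move=> Hc A X Y iA XA YA.
have Hp (p : P) := Hc A (fun l => X (p, l)) (fun l => Y (p, l)) iA
  (fun _ _ _ => XA _ _ _) (fun _ _ _ => YA _ _ _).
apply: slp_weaken (slp_bigcup Hp) (leqnn _) _.
by move=> _ [[[p l] [i k]] _ <-]; right; exists p => //; exists (l, (i, k)).
Qed.

Lemma mulcost_unit : mulcost unit unit 1.
Proof.
move=> A X Y iA XA YA.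
apply: slp_weaken (slp_op (slp_id A) (XA tt tt tt) (YA tt tt tt)
  (Or33 _ _ erefl)) (leqnn _) _.
move=> _ [[[] [[] []]] _ <-]; left.
by rewrite (bigD1 tt) //= big1 ?addr0 // => -[].
Qed.

(** This says that the rank is at most [#|L|]; an arbitrary finite type [L] allows terms to be
    indexed by pairs. *)
Definition decomposition (L X Y Z : finType) (t : tensor F X Y Z) : Prop :=
  exists (a : L -> X -> F) (b : L -> Y -> F) (c : L -> Z -> F),
    forall i j k, t i j k = \sum_l a l i * b l j * c l k.

(* Bilinear recursion: the blocks of the factors are combined into [#|L|] pairs
   of matrices, whose products are combined into the blocks of the results. *)
Lemma mulcost_step (L I : finType) (H m c : nat) :
  decomposition L (copies H (matmul_tensor F m m m)) -> mulcost L I c ->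
  mulcost 'I_H ('I_m * I)%type
    (c + 6 * #|L| * H * m ^ 2 * #|I| ^ 2).
Proof.
move=> [a [b [d tE]]] Hc A X Y iA XA YA.
pose V := ('I_H * ('I_m * 'I_m))%type.
pose J := (L * (I * I))%type.
have cardV : #|{: V}| = (H * m ^ 2)%N.
  by rewrite !card_prod !card_ord mulnn.
have cardJ : #|{: J}| = (#|L| * #|I| ^ 2)%N by rewrite !card_prod mulnn.
pose blk (T : 'I_H -> 'I_m * I -> 'I_m * I -> K) (x : V) (u v : I) :=
  T x.1 (x.2.1, u) (x.2.2, v).
pose P l u v := \sum_x iota (a l x) * blk X x u v.
pose Q l u v := \sum_x iota (b l x) * blk Y x u v.
pose S (p : L * (I * I)) := \sum_v P p.1 p.2.1 v * Q p.1 v p.2.2.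
have sP : slp A (#|{: J}| * (2 * #|{: V}|))
    (A `|` range (fun p : J => P p.1 p.2.1 p.2.2)).
  by apply: (slp_lincombs (fun p : J => a p.1)) => // p x; apply: XA.
set A1 := A `|` _ in sP.
have sQ : slp A1 (#|{: J}| * (2 * #|{: V}|))
    (A1 `|` range (fun p : J => Q p.1 p.2.1 p.2.2)).
  apply: (slp_lincombs (fun p : J => b p.1)); first by move=> w /iA; left.
  by move=> p x; left; apply: YA.
set A2 := A1 `|` _ in sQ.
have iA2 : range iota `<=` A2 by move=> w /iA Aw; do 2 left.
have sS : slp A2 c (range S).
  apply: Hc => // l u v; first by left; right; exists (l, (u, v)).
  by right; exists (l, (u, v)).
(* The third index of [d] is transposed, because the third variables of the matrix multiplication
   tensor are the c_{ki}. *)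
have sZ : slp (A2 `|` range S) (#|{: V * (I * I)}| * (2 * #|L|))
  ((A2 `|` range S) `|` range (fun q : V * (I * I) =>
    \sum_l iota (d l (q.1.1, (q.1.2.2, q.1.2.1))) * S (l, q.2))).
  apply: (slp_lincombs (fun (q : V * (I * I)) l =>
    d l (q.1.1, (q.1.2.2, q.1.2.1)))); first by move=> w /iA2; left.
  by move=> q l; right; exists (l, q.2).
(* The combinations forming [P], [Q] and the results each cost [2 * #|L| * H * m ^ 2 * #|I| ^ 2],
   whence the factor 6. *)
apply: slp_weaken
  (slp_trans sP (slp_trans sQ (slp_trans (slp_keep sS) sZ))) _ _.
  rewrite addnCA addnC -!addnA leq_add2l {sP sQ sS sZ A1 A2 iA2}.
  rewrite (card_prod V) cardV cardJ card_prod mulnn.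
  by apply/eq_leq; lia.
move=> _ [[h [[i u] [k w]]] _ <-]; right; exists ((h, (i, k)), (u, w)) => //=.
rewrite /S /=.
(* Expanding [P] and [Q] and summing over [l] first recovers the coefficients of the tensor. *)
transitivity (\sum_v \sum_x \sum_y blk X x u v * blk Y y v w *
   iota (copies H (matmul_tensor F m m m) x y (h, (k, i)))).
  under eq_bigr do rewrite mulr_sumr.
  rewrite exchange_big /=; apply: eq_bigr => v _.
  under [in RHS]eq_bigr => x _ do under eq_bigr => y _ do
    rewrite tE rmorph_sum mulr_sumr.
  under [in RHS]eq_bigr do rewrite exchange_big /=.
  rewrite [in RHS]exchange_big /=; apply: eq_bigr => l _.
  rewrite /P /Q big_distrlr /= mulr_sumr; apply: eq_bigr => x _.
  rewrite mulr_sumr; apply: eq_bigr => y _.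
  rewrite !rmorphM; ring.
transitivity (\sum_v \sum_j X h (i, u) (j, v) * Y h (j, v) (k, w)); last first.
  by rewrite exchange_big pair_big; apply: eq_bigr => -[].
apply: eq_bigr => v _.
(* For a given [x], at most one [y] has a nonzero coefficient: [x = (h, (i, j))] forces
   [y = (h, (j, k))]. *)
transitivity (\sum_(x : V | (x.1 == h) && (x.2.1 == i))
    blk X x u v * Y h (x.2.2, v) (k, w)).
  rewrite [RHS]big_mkcond; apply: eq_bigr => -[h' [i' j']] _ /=.
  rewrite (bigD1 (h', (j', k))) //= big1 ?addr0 => [|[h2 [j2 k2]] ne].
    rewrite /copies /matmul_tensor /= !eqxx /= /blk /= [i == i']eq_sym.
    have [->|_] := eqVneq h' h; last by rewrite rmorph0 mulr0.
    by case: eqVneq => _; rewrite ?rmorph1 ?rmorph0 ?mulr0 ?mulr1.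
  rewrite /copies /matmul_tensor /=.
  case: ifP => [/andP[/eqP hE _]|_]; last by rewrite rmorph0 mulr0.
  case: eqVneq => [jE|_]; last by rewrite rmorph0 mulr0.
  case: eqVneq => [kE|_]; last by rewrite rmorph0 mulr0.
  by move: ne; rewrite hE jE kE eqxx.
rewrite (reindex (fun j => (h, (i, j)))) /=; last first.
  exists (fun x : V => x.2.2) => [//|[h' [i' j]]].
  by rewrite inE /= => /andP[/eqP-> /eqP->].
by apply: eq_big => j; rewrite ?eqxx.
Qed.

End StraightLinePrograms.

(** * Rank decompositions and the costs they yield *)

Section Rank.
Variable F : fieldType.

Lemma tensor_rank_decomposition (X Y Z : finType) (t : tensor F X Y Z) :
  decomposition 'I_(tensor_rank t) t.
Proof.
(* One rank-one term per coefficient always works, so the rank is a true minimum and not the default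
   value of [least]. *)
have ex : exists n, exists2 u : 'I_n -> tensor F X Y Z,
    (forall l, rank_one (u l)) &
    (forall i j k, t i j k = \sum_(l < n) u l i j k).
  exists #|{: X * Y * Z}|.
  pose u (p : X * Y * Z) i j k :=
    t p.1.1 p.1.2 p.2 * ((i == p.1.1)%:R * (j == p.1.2)%:R * (k == p.2)%:R).
  exists (fun l => u (enum_val l)) => [l|i j k].
    case: (enum_val l) => [[x y] z].
    exists (fun i => t x y z * (i == x)%:R), (fun j => (j == y)%:R),
      (fun k => (k == z)%:R) => i j k.
    by rewrite /u /= !mulrA.
  rewrite -(big_enum_val (A := {: X * Y * Z}) (fun p => u p i j k)) /=.
  rewrite (bigD1 (i, j, k)) //= /u /= !eqxx !mulr1 big1 ?addr0 //.
  move=> [[x y] z]; rewrite !xpair_eqE !negb_and -orbA /=.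
  by case/or3P=> /negPf; rewrite eq_sym => ->; rewrite ?(mul0r, mulr0).
have [u u1 tE] := leastP ex.
have [a aE] := choice u1; have [b bE] := choice aE; have [c cE] := choice bE.
exists a, b, c => i j k; rewrite tE; apply: eq_bigr => l _; exact: cE.
Qed.

(** The indicator factors confine the terms labelled by a copy to the variables of that copy. *)
Lemma decomposition_copies (L X Y Z : finType) (t : tensor F X Y Z) C :
  decomposition L t -> decomposition ('I_C * L)%type (copies C t).
Proof.
move=> [a [b [c tE]]].
exists (fun l i => (i.1 == l.1)%:R * a l.2 i.2),
  (fun l j => (j.1 == l.1)%:R * b l.2 j.2),
  (fun l k => (k.1 == l.1)%:R * c l.2 k.2) => -[h i] [h' j] [h'' k].
rewrite /copies /= -(pair_big predT predT (fun x l =>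
  (h == x)%:R * a l i * ((h' == x)%:R * b l j) * ((h'' == x)%:R * c l k))) /=.
rewrite (bigD1 h) //= [X in _ + X]big1 ?addr0 => [|x ne]; last first.
  by rewrite big1 // => l _; rewrite eq_sym (negPf ne) !mul0r.
have [<-|_] := eqVneq h h'; last first.
  by rewrite big1 // => l _; rewrite mul0r mulr0 mul0r.
have [_|_] := eqVneq h h''; last first.
  by rewrite big1 // => l _; rewrite mul0r mulr0.
by rewrite ?eqxx tE; apply: eq_bigr => l _; rewrite !mul1r.
Qed.

Lemma decomposition_zeroing_out (L X Y Z X' Y' Z' : finType)
    (t : tensor F X Y Z) (t' : tensor F X' Y' Z') :
  zeroing_out t' t -> decomposition L t -> decomposition L t'.
Proof.
move=> [f [g [h [_ _ _ t'E]]]] [a [b [c tE]]].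
exists (fun l => a l \o f), (fun l => b l \o g), (fun l => c l \o h).
by move=> i j k; rewrite t'E tE.
Qed.

(* Restricting the flattening of the tensor to the pairs of variables [b_(j,0)],
   [c_(0,i)] gives the identity matrix. *)
Lemma decomposition_matmul_lb (L : finType) (H m : nat) :
  (0 < m)%N -> decomposition L (copies H (matmul_tensor F m m m)) ->
  (H * m ^ 2 <= #|L|)%N.
Proof.
case: m => // m _ [a [b [c tE]]]; pose V := ('I_H * ('I_m.+1 * 'I_m.+1))%type.
have <- : #|{: V}| = (H * m.+1 ^ 2)%N by rewrite !card_prod !card_ord mulnn.
pose A : 'M[F]_(#|{: V}|, #|L|) := \matrix_(v, l) a (enum_val l) (enum_val v).
pose B : 'M[F]_(#|L|, #|{: V}|) := \matrix_(l, v)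
  (b (enum_val l) ((enum_val v).1, ((enum_val v).2.2, ord0)) *
   c (enum_val l) ((enum_val v).1, (ord0, (enum_val v).2.1))).
have AB1 : A *m B = 1%:M.
  apply/matrixP => v w; rewrite !mxE.
  transitivity (copies H (matmul_tensor F m.+1 m.+1 m.+1) (enum_val v)
     ((enum_val w).1, ((enum_val w).2.2, ord0))
     ((enum_val w).1, (ord0, (enum_val w).2.1))).
    rewrite tE (reindex _ (onW_bij _ (enum_val_bij L))) /=.
    by apply: eq_bigr => l _; rewrite !mxE mulrA.
  rewrite -(inj_eq enum_val_inj).
  case: (enum_val v) (enum_val w) => [h [i j]] [h' [i' j']].
  rewrite /copies /matmul_tensor /= !eqxx !andbT !xpair_eqE [i' == i]eq_sym.
  by case: (h == h') => //=; rewrite andbC.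
rewrite -(mxrank1 F #|{: V}|) -AB1.
exact: leq_trans (mxrankM_maxl _ _) (rank_leq_col _).
Qed.

(** With [r = #|L|], the [r] smaller products form at most [r %/ H + 1] batches of [H], so the cost
    satisfies c(t+1) <= (r %/ H + 1) c(t) + D m^(2t). Using [r %/ H + 2] as ratio absorbs the last
    term, since m^2 <= r / H. In [D], the summand [H] pays for the base case, [H] scalar
    products. *)
Lemma mulcost_pow (K : fieldType) (iota : {rmorphism F -> K}) (L : finType)
    (H m : nat) t :
  (0 < m)%N -> (0 < H)%N ->
  decomposition L (copies H (matmul_tensor F m m m)) ->
  mulcost iota 'I_H 'I_(m ^ t)
    ((H + 6 * #|L| * H * m ^ 2) * (#|L| %/ H + 2) ^ t).
Proof.
move=> m0 H0 dec; set D := (H + _)%N; set q := (_ + 2)%N.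
have m2q : (m ^ 2 <= q)%N.
  rewrite (leq_trans _ (leq_addr _ _)) // leq_divRL // mulnC.
  exact: decomposition_matmul_lb.
elim: t => [|t IH].
  rewrite expn0 muln1.
  apply: mulcost_weaken (leq_addr _ _).
  have := mulcost_mul (P := 'I_H) (@mulcost_unit F K iota).
  rewrite card_ord muln1.
  by apply: mulcost_card; rewrite ?card_prod ?card_ord ?card_unit ?muln1.
(* The last batch may be incomplete and is padded. *)
have le : (#|L| <= #|{: 'I_(#|L| %/ H + 1) * 'I_H}|)%N.
  by rewrite card_prod !card_ord addn1 ltnW // ltn_ceil.
have := mulcost_mul (P := 'I_(#|L| %/ H + 1)) IH.
move=> /(mulcost_card le (leqnn _)) /(mulcost_step dec).
rewrite !card_ord => /(@mulcost_card _ _ _ _ 'I_H _ 'I_(m ^ t.+1)).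
rewrite !card_prod !card_ord expnS => /(_ (leqnn _) (leqnn _)).
move=> /mulcost_weaken; apply.
have mtq : ((m ^ t) ^ 2 <= q ^ t)%N.
  by rewrite expnAC; case: (posnP t) => [->//|t0]; rewrite leq_exp2r.
(* One of the [q] shares of [D * q ^ t] is set aside for the linear combinations. *)
have -> : (D * q ^ t.+1 = (#|L| %/ H + 1) * (D * q ^ t) + D * q ^ t)%N.
  by rewrite expnS /q; lia.
rewrite leq_add2l leq_mul // /D; exact: leq_addl.
Qed.

(** The bound is applied in the field of rational functions, where the entries of both generic
    matrices are inputs of the circuit. *)
Lemma mulmx_cost_le n c :
  (forall (K : fieldType) (iota : {rmorphism F -> K}),
    mulcost iota unit 'I_n c) ->
  (mulmx_cost F n n n <= c)%N.
Proof.
move=> Hc; pose K := ratfun F n n n.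
pose iota : {rmorphism F -> K} :=
  (@tofrac _) \o (@mpoly.mpolyC (n * n + n * n) F).
pose x := @ratfun_var F n n n.
pose A := range x `|` range iota.
have XA (l : unit) i j : A (left_mx F n n n i j).
  by left; rewrite mxE; exists (lshift (n * n) (mxvec_index i j)).
have YA (l : unit) i j : A (right_mx F n n n i j).
  by left; rewrite mxE; exists (rshift (n * n) (mxvec_index i j)).
have := Hc K iota A (fun=> left_mx F n n n) (fun=> right_mx F n n n)
  (@subsetUr _ _ _) XA YA.
move=> /slp_circuit-/(_ _ iota _ x (fun _ => id)) [p [vals [ple rp outp]]].
apply: leq_trans ple; apply: least_le; exists p => //; exists vals => // -[i k].
have [|ow owE] := outp ((left_mx F n n n *m right_mx F n n n) i k).
  by exists (tt, (i, k)) => //; rewrite mxE.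
by exists ow; rewrite -[vals]cats0 owE.
Qed.

(** This serves the case [m N = 1] of the theorem, where m^k does not grow and cannot absorb a
    constant. *)
Lemma mulmx_cost1 : (mulmx_cost F 1 1 1 <= 1)%N.
Proof.
apply: mulmx_cost_le => K iota; have := @mulcost_unit F K iota.
by apply: mulcost_card; rewrite ?card_ord card_unit.
Qed.

Lemma mulmx_cost_pow (L : finType) (H m n t : nat) :
  (0 < m)%N -> (0 < H)%N ->
  decomposition L (copies H (matmul_tensor F m m m)) -> (n <= m ^ t)%N ->
  (mulmx_cost F n n n <=
     (H + 6 * #|L| * H * m ^ 2) * (#|L| %/ H + 2) ^ t)%N.
Proof.
move=> m0 H0 dec le; apply: mulmx_cost_le => K iota.
have := mulcost_pow (iota := iota) (t := t) m0 H0 dec.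
by apply: mulcost_card; rewrite ?card_unit !card_ord.
Qed.

End Rank.

(** * Asymptotic estimates and the exponent of matrix multiplication *)

Section Exponent.
Variable R : realType.

(** This is exp(y) >= 1 + y at y = x ln a; linear growth of the exponent suffices below. *)
Lemma powR_gt_linear (a x : R) : 0 < a -> x * ln a < a `^ x.
Proof.
move=> a0; rewrite /powR gt_eqF //.
by apply: lt_le_trans (expR_ge1Dx _); rewrite ltrDr.
Qed.

Lemma is_ThetaP (u v : nat -> R) : is_Theta u v ->
  exists c d : R, [/\ 0 < c, 0 < d &
    \forall N \near \oo, c * `|v N| <= `|u N| <= d * `|v N|].
Proof.
rewrite /is_Theta eqThetaE qualifE => /asboolP[[c d] /= /andP[c0 d0] uv].
exists c, d; split=> //; apply: filterS uv => N [le1 le2].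
by apply/andP; split.
Qed.

Lemma near_sqrt_log (r : R) : \forall N \near \oo, r < sqrt_log R N.
Proof.
near=> N; have ltN : expR (r ^+ 2) < N%:R by near: N; exact: nbhs_infty_gtr.
have N0 : 0 < N%:R :> R by apply: lt_trans ltN; exact: expR_gt0.
have r2N : r ^+ 2 < ln N%:R.
  by rewrite -[X in X < _]expRK ltr_ln ?posrE ?expR_gt0.
apply: le_lt_trans (ler_norm r) _; rewrite -sqrtr_sqr ltr_sqrt //.
by apply: le_lt_trans r2N; rewrite sqr_ge0.
Unshelve. all: by end_near. Qed.

Lemma exp2_Theta_large (m : nat -> nat) (r : R) :
  exp2_Theta m (fun N => N%:R : R) -> \forall N \near \oo, r < (m N)%:R.
Proof.
move=> [e /is_ThetaP[c [d [c0 d0 ce]]] mE]; near=> N.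
have N0 : (0 < N)%N by near: N; exists 1%N.
have /andP[cN _] : c * `|N%:R| <= `|e N| <= d * `|N%:R| by near: N.
have ln2 : 0 < ln 2 :> R by rewrite ln_gt0 // ltr1n.
have rN : r / (c * ln 2) < N%:R by near: N; exact: nbhs_infty_gtr.
(* The Theta relation only controls the absolute value of [e N]; its sign comes from [m N] being a
   positive integer. *)
have e0 : 0 <= e N.
  have m1 : 1 <= 2 `^ e N :> R.
    by rewrite -mE // ler1n -(ltr0n R) mE // powR_gt0.
  by have := ln_ge0 m1; rewrite ln_powR pmulr_lge0.
rewrite mE //; apply: lt_trans (powR_gt_linear _ _) => //.
rewrite ger0_norm // in cN; rewrite ger0_norm // in cN.
rewrite ltr_pdivrMr ?mulr_gt0 // in rN.
by apply: lt_le_trans rN _; rewrite mulrCA mulrA ler_pM2r // mulrC.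
Unshelve. all: by end_near. Qed.

Lemma near_le_inv_sqrt_log (f : nat -> R) :
  (forall N, 0 < f N) -> is_Theta (fun N => 1 / f N) (sqrt_log R) ->
  exists2 c, 0 < c & \forall N \near \oo, f N <= c / sqrt_log R N.
Proof.
move=> f0 /is_ThetaP[c [d [c0 d0 cf]]]; exists c^-1; first by rewrite invr_gt0.
near=> N.
have s0 : 0 < sqrt_log R N by near: N; exact: near_sqrt_log.
have /andP[le _] : c * `|sqrt_log R N| <= `|1 / f N| <= d * `|sqrt_log R N|.
  by near: N.
rewrite gtr0_norm // gtr0_norm ?divr_gt0 // in le.
rewrite -invfM -[f N]invrK lef_pV2 ?posrE ?invr_gt0 ?mulr_gt0 //.
by rewrite -div1r.
Unshelve. all: by end_near. Qed.

Lemma near_le_of_Theta (f : nat -> R) (eps : R) :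
  (forall N, 0 < f N) -> is_Theta (fun N => 1 / f N) (sqrt_log R) -> 0 < eps ->
  \forall N \near \oo, f N <= eps.
Proof.
move=> f0 /(near_le_inv_sqrt_log f0)[c c0 fc] eps0; near=> N.
have s0 : 0 < sqrt_log R N by near: N; exact: near_sqrt_log.
have sN : c / eps < sqrt_log R N by near: N; exact: near_sqrt_log.
apply: (@le_trans _ _ (c / sqrt_log R N)); first by near: N.
by rewrite ler_pdivrMr // mulrC -ler_pdivrMr // ltW.
Unshelve. all: by end_near. Qed.

Lemma mulmx_cost_exponent (F : fieldType) (omega0 e : R) (f : nat -> R) :
  (forall N, 0 < f N) -> is_Theta (fun N => 1 / f N) (sqrt_log R) ->
  CW_family F omega0 f -> omega0 < e ->
  exists D : R, forall n, (0 < n)%N ->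
    (mulmx_cost F n n n)%:R <= D * n%:R `^ e.
Proof.
move=> f0 fT [m_ [H_ [C_ [pos mT _ _ fam]]]] lt_e.
(* One [eps] pays for [f N], the other for the factor 3, which is at most m^eps once m exceeds
   3^(1/eps). *)
pose eps := (e - omega0) / 2; have eps0 : 0 < eps by rewrite divr_gt0 ?subr_gt0.
near \oo => N.
have N0 : (0 < N)%N by near: N; exists 1%N.
have fN : f N <= eps by near: N; apply: near_le_of_Theta.
have m1 : 1 < (m_ N)%:R :> R by near: N; apply: exp2_Theta_large.
have m3 : 3 `^ eps^-1 < (m_ N)%:R :> R by near: N; apply: exp2_Theta_large.
have [zo rankle] :
    zeroing_out (copies (H_ N) (matmul_tensor F (m_ N) (m_ N) (m_ N)))
      (copies (C_ N) (kronecker_pow N (CW F 5))) /\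
    (C_ N)%:R * (tensor_rank (kronecker_pow N (CW F 5)))%:R / (H_ N)%:R
      <= (m_ N)%:R `^ (omega0 + f N) by near: N.
have [m0 H0 _] := pos N N0.
move: (m_ N) (H_ N) (C_ N) m1 m3 zo rankle m0 H0 => m H C m1 m3 zo rankle m0 H0.
pose L := ('I_C * 'I_(tensor_rank (kronecker_pow N (CW F 5))))%type.
have dec : decomposition L (copies H (matmul_tensor F m m m)).
  apply: decomposition_zeroing_out zo _; apply: decomposition_copies.
  exact: tensor_rank_decomposition.
have {rankle} : #|{: L}|%:R / H%:R <= m%:R `^ (omega0 + f N).
  by rewrite card_prod !card_ord natrM.
have := decomposition_matmul_lb m0 dec.
have := mulmx_cost_pow m0 H0 dec.
move: #|{: L}| => r cost lb rankle.
set q := (r %/ H + 2)%N in cost; set D0 := (H + _)%N in cost.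
have H0R : 0 < H%:R :> R by rewrite ltr0n.
have q_le : q%:R <= m%:R `^ e.
  (* As r >= H m^2 >= H, the 2 in [q] is at most 2 r / H. *)
  have rH1 : 1 <= r%:R / H%:R :> R.
    rewrite ler_pdivlMr // mul1r ler_nat; apply: leq_trans lb.
    by rewrite leq_pmulr // expn_gt0 m0.
  have q3 : q%:R <= 3 * (r%:R / H%:R) :> R.
    have : (r %/ H)%:R <= r%:R / H%:R :> R.
      by rewrite ler_pdivlMr // -natrM ler_nat leq_trunc_div.
    by rewrite /q natrD; lra.
  apply: le_trans q3 _.
  have -> : e = eps + (omega0 + eps) by rewrite /eps; field.
  rewrite powRD; last by apply/implyP => _; rewrite pnatr_eq0 -lt0n.
  apply: ler_pM => //.
    have {1}-> : 3 = (3 `^ eps^-1) `^ eps :> R.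
      by rewrite -powRrM mulVf ?powRr1 ?gt_eqF.
    by apply: ge0_ler_powR; rewrite ?nnegrE ?powR_ge0 // ltW.
  apply: le_trans rankle _; apply: ler_powR; first exact: ltW.
  by rewrite lerD2l.
(* If [e] were negative, m^e <= 1 would contradict 2 <= q <= m^e. The sign makes n^e monotone in
   n. *)
have e0 : 0 <= e.
  rewrite leNgt; apply/negP => /ltW /(ler_powR (ltW m1)).
  by rewrite powRr0 => /(le_trans q_le); rewrite (ler_nat R q 1) /q addn2.
(* The factor m^e pays for rounding [n] up to a power of [m], which is at most m n. *)
exists (D0%:R * m%:R `^ e) => n n0.
have m1N : (1 < m)%N by rewrite -(ltr_nat R).
pose t := up_log m n.
have mt : (m ^ t <= m * n)%N.
  (* For [n = 1] the logarithm is 0, and the power is 1. *)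
  have [n1|n1] := leqP n 1.
    by rewrite /t (_ : n = 1%N) ?up_log1 ?muln1 //; lia.
  have /andP[lt _] := up_log_bounds m1N n1.
  have t0 : (0 < t)%N by rewrite up_log_gt0 m1N.
  by rewrite -(prednK t0) expnS leq_mul // ltnW.
apply: (@le_trans _ _ (D0 * q ^ t)%:R).
  by rewrite ler_nat cost // up_logP.
rewrite natrM -mulrA ler_wpM2l // natrX.
apply: (@le_trans _ _ ((m%:R `^ e) ^+ t)).
  by rewrite lerXn2r // nnegrE ?powR_ge0.
(* Exchanging exponents, (m^e)^t = (m^t)^e <= (m n)^e. *)
rewrite -powRM // -natrM -powR_mulrn ?powR_ge0 // powRAC powR_mulrn // -natrX.
by apply: ge0_ler_powR => //; rewrite ?nnegrE // ler_nat.
Unshelve. all: by end_near. Qed.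

End Exponent.

(** * The bound for powers of m *)

Theorem theorem7p3 (F : fieldType) (R : realType) (omega0 : R) (f : nat -> R)
  (omega0_lt : omega0 < 2372%:R / 1000%:R)
  (f01 : forall N, 0 < f N < 1)
  (f_asymp : is_Theta (fun N => 1 / f N) (sqrt_log R))
  (family : CW_family F omega0 f) :
  exists m H C : nat -> nat,
    [/\ forall N, (0 < N)%N -> [/\ 0 < m N, 0 < H N & 0 < C N]%N,
        exp2_Theta m (fun N => N%:R : R),
        exp2_Theta H (fun N => N%:R : R),
        le_exp2_O C (fun N => N%:R / log R N) &
        exists g p h1 h2 : nat -> R,
          [/\ (forall N, (0 < N)%N -> 0 < g N) /\ is_Theta g (sqrt_log R),
              is_O p (fun N =>
                (m N)%:R `^ (omega0 + f (floor_sqrt R N)) * N%:R),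
              is_O h1 (fun N => N%:R / sqrt_log R N),
              is_O h2 (fun N => N%:R * log R N) &
              forall N, (0 < N)%N -> \forall k \near \oo,
                (mulmx_cost F (m N ^ k) (m N ^ k) (m N ^ k))%:R
                  <= (H N)%:R `^ (1 / g N) * (m N)%:R `^ ((omega0 + f N) * k%:R)
                     + p N * (m N)%:R ^+ (2 * k)
                  <= 2 `^ h1 N * (m N)%:R `^ ((omega0 + f N) * k%:R)
                     + 2 `^ h2 N * (m N)%:R ^+ (2 * k)]].
Proof.
have f0 N : 0 < f N by case/andP: (f01 N).
have cost := mulmx_cost_exponent f0 f_asymp family.
have [m [H [C [pos mT HT CO _]]]] := family.
exists m, H, C; split=> //.
have [eH eHT HE] := HT.
(* With g = 1/f the first factor is H^f = 2^(eH f). The first term alone will bound the cost, so [p]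
   and [h2] are 0. *)
exists (fun N => 1 / f N), (fun=> 0), (fun N => eH N * f N), (fun=> 0); split.
- by split=> // N _; rewrite divr_gt0.
- apply/eqO_exP; exists 1 => //; near=> N.
  by rewrite normr0 mul1r.
(* Here [eH] is O(N) and [f] is O(1 / sqrt(log N)). *)
- have [c [d [c0 d0 ed]]] := is_ThetaP eHT.
  have [b b0 fb] := near_le_inv_sqrt_log f0 f_asymp.
  apply/eqO_exP; exists (d * b); first exact: mulr_gt0.
  near=> N.
  have s0 : 0 < sqrt_log R N by near: N; exact: near_sqrt_log.
  have /andP[_ eN] : c * `|N%:R| <= `|eH N| <= d * `|N%:R| by near: N.
  have fN : f N <= b / sqrt_log R N by near: N.
  rewrite normrM [`|f N|]gtr0_norm // normrM.
  rewrite [`|_^-1|]gtr0_norm ?invr_gt0 // mulrACA.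
  by apply: ler_pM => //; exact: ltW.
- apply/eqO_exP; exists 1 => //; near=> N.
  by rewrite normr0 mul1r.
move=> N N0; have [m0 H0 _] := pos N N0.
have HE2 : (H N)%:R `^ (1 / (1 / f N)) = 2 `^ (eH N * f N).
  by rewrite HE // !div1r invrK powRrM.
(* This lets the factor H^f be dropped when bounding the cost. *)
have H1 : 1 <= (H N)%:R `^ (1 / (1 / f N)).
  rewrite -[leLHS](powRr0 (H N)%:R) ler_powR ?ler1n //.
  by rewrite !div1r invrK ltW.
(* Half of [f N] puts the exponent strictly above [omega0]; the other half remains to absorb the
   constant [D]. *)
pose e := omega0 + f N / 2.
have [|D DP] := cost e; first by rewrite ltrDl divr_gt0.
near=> k; apply/andP; split; last first.
  by rewrite HE2 mul0r lerD2l powRr0 mul1r exprn_ge0.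
rewrite mul0r addr0.
apply: (@le_trans _ _ ((m N)%:R `^ ((omega0 + f N) * k%:R))); last first.
  by rewrite -[leLHS]mul1r ler_wpM2r // powR_ge0.
have [m1|m1] := leqP (m N) 1.
  have -> : m N = 1%N by lia.
  by rewrite exp1n powR1 (@ler_nat R _ 1) mulmx_cost1.
apply: le_trans (DP _ _) _; first by rewrite expn_gt0 m0.
have mR0 : 0 < (m N)%:R :> R by rewrite ltr0n.
have lnm : 0 < ln (m N)%:R :> R by rewrite ln_gt0 // ltr1n.
have -> : (omega0 + f N) * k%:R = f N / 2 * k%:R + k%:R * e.
  by rewrite /e; field.
rewrite [leRHS]powRD; last by apply/implyP => _; rewrite pnatr_eq0 -lt0n.
rewrite natrX -powR_mulrn // -powRrM ler_wpM2r ?powR_ge0 //.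
(* It remains to have D <= (f N / 2) k ln m, which holds for large [k]. *)
apply: le_trans (ltW (powR_gt_linear _ mR0)).
have kN : D / (f N / 2 * ln (m N)%:R) < k%:R.
  by near: k; exact: nbhs_infty_gtr.
have fl : 0 < f N / 2 * ln (m N)%:R by rewrite mulr_gt0 ?divr_gt0.
by rewrite mulrAC mulrC -ler_pdivrMr // ltW.
Unshelve. all: by end_near. Qed.
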